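(* Let $V_a$, $\{V_{a_i}\}_{i\in\mathbb{N}}$, $\{R_i\}_{i\in\mathbb{N}}$ be a space splitting as in the context: $\mathrm{span}(\{R_iV_{a_i}\}_{i\in\mathbb{N}})$ is dense in $V_a$, and for some constant $\Lambda$ one has $\|R_iv_i\|_a\le \Lambda\|v_i\|_{a_i}$ for all $v_i\in V_{a_i}$, $i\in\mathbb{N}$. Let $u\in V_a$ be the solution of the variational problem $a(u,v)=F(v)$ for all $v\in V$. Let $u^{(m)}$, $m\ge 0$, be the iterates of the Schwarz iterative method described in the context, with $u^{(0)}=0$, $\alpha_m=1-(m+2)^{-1}$, and $\omega_m$ given by exact error minimization. a) (Greedy ordering.) Let $\beta\in(0,1]$ and assume that for every $m\ge 0$ the index $i_m\in\mathbb{N}$ satisfies $$a_{i_m}(r^{(m)}_{i_m},r^{(m)}_{i_m})\ge \beta^2\sup_{i\in\mathbb{N}}a_i(r^{(m)}_i,r^{(m)}_i),\qquad r^{(m)}_i:=T_i(u-u^{(m)}).$$ If $u\in\mathcal{A}_1$, then $$\|u-u^{(m)}\|_a^2\le 2\left(\|u\|_a^2+(\Lambda/\beta)^2\|u\|_{\mathcal{A}_1}^2\right)(m+1)^{-1},\qquad m\ge 0.$$ b) (Random ordering.) Assume that the indices $i_m\in\mathbb{N}$, $m\ge 0$, are chosen randomly and independently according to a fixed discrete probability distribution $\pi=\{\pi_i\}_{i\in\mathbb{N}}$. If $u\in\mathcal{A}^{\pi}_\infty$, then $$E(\|u-u^{(m)}\|_a^2)\le 2\left(\|u\|_a^2+\Lambda^2\|u\|_{\mathcal{A}^{\pi}_\infty}^2\right)(m+1)^{-1},\qquad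 m\ge 0.$$
   Context: **Setting.** $V$ is a separable real or complex Hilbert space, $a(\cdot,\cdot)$ is a continuous coercive Hermitian form on $V$, and $V_a$ denotes $V$ equipped with the (equivalent) scalar product $a$ and norm $\|v\|_a=a(v,v)^{1/2}$. Hermitian forms are linear in the first argument. $F$ is a bounded linear functional on $V$ (conjugate-linear in the complex case), so that the problem ''find $u\in V$ with $a(u,v)=F(v)$ for all $v\in V$'' has a unique solution. For each $i\in\mathbb{N}$, $V_{a_i}$ is a Hilbert space with scalar product $a_i(\cdot,\cdot)$ and norm $\|\cdot\|_{a_i}$, and $R_i:V_{a_i}\to V_a$ is a bounded linear operator. No stability of the splitting is assumed. **Operators $T_i$.** $T_i:V_a\to V_{a_i}$ is defined by $a_i(T_iv,v_i)=a(v,R_iv_i)$ for all $v_i\in V_{a_i}$. **Schwarz iterative method.** Given $u^{(m)}$, an index $i=i_m\in\mathbb{N}$ is picked (by the rule specified in the claim), one computes $r_i^{(m)}=T_i(u-u^{(m)})$ and sets $$u^{(m+1)}=\alpha_mu^{(m)}+\omega_mR_ir_i^{(m)},\qquad \alpha_m=1-(m+2)^{-1},\qquad \omega_m=\frac{a(u-\alpha_mu^{(m)},R_ir_i^{(m)})}{\|R_ir_i^{(m)}\|_a^2},$$ i.e. $\omega_m$ is the minimizer of $\omega\mapsto\|u-\alpha_mu^{(m)}-\omega R_ir_i^{(m)}\|_a$ over scalars $\omega$. If $R_ir_i^{(m)}=0$, the value of $\omega_m$ is irrelevant and $u^{(m+1)}=\alpha_mu^{(m)}$. **Approximation spaces.**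 A discrete probability distribution is a sequence $\pi=\{\pi_i\}_{i\in\mathbb{N}}$ with $\pi_i\ge0$, $\sum_i\pi_i=1$; $\mathrm{supp}(\pi)=\{i:\pi_i>0\}$. For a non-negative weight sequence $\gamma=\{\gamma_i\}_{i\in\mathbb{N}}$ and $0<q\le\infty$, define for $u\in\mathrm{span}(\{R_iV_{a_i}\}_{i\in\mathrm{supp}(\gamma)})$ $$\|u\|_{\mathcal{A}^\gamma_q}=\inf\left\{\big\|\{\gamma_i^{-1}\|v_i\|_{a_i}\}_{i\in I}\big\|_{\ell^q}:\ u=\sum_{i\in I}R_iv_i,\ v_i\in V_{a_i},\ I\subset\mathrm{supp}(\gamma)\text{ finite}\right\},$$ and let $\mathcal{A}^\gamma_q$ be the completion with respect to this (quasi-)norm. $\mathcal{A}_q$ denotes the case $\gamma_i=1$ for all $i$. For $\mathcal{A}_1$ and $\mathcal{A}_\infty^\pi$ one has $\|\cdot\|_a\le\Lambda\|\cdot\|_{\mathcal{A}}$ on finite sums, and elements of these completions are regarded as elements of $V_a$ via the continuous extension of the inclusion of the span into $V_a$. *)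

(* Defs.v *)
From HB Require Import structures.
From mathcomp Require Export all_boot all_order all_algebra finmap.
From mathcomp.real_closed Require Export complex.
From mathcomp Require Export all_classical all_reals all_analysis.

Set Implicit Arguments.
Unset Strict Implicit.
Unset Printing Implicit Defensive.

Import Order.TTheory GRing.Theory Num.Theory.
Import numFieldNormedType.Exports.

Local Open Scope classical_set_scope.
Local Open Scope ring_scope.

Variant scalar_kind := RealScalars | ComplexScalars.

Definition scalar (R : realType) (k : scalar_kind) : numFieldType :=
  match k with RealScalars => R | ComplexScalars => R[i] end.

Definition scalar_conj (R : realType) (k : scalar_kind) :
    {rmorphism scalar R k -> scalar R k} :=
  match k with RealScalars => idfun | ComplexScalars => @conjc R end.

Definition scalar_re (R : realType) (k : scalar_kind) : scalar R k -> R :=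
  match k return scalar R k -> R with
  | RealScalars => fun x => x
  | ComplexScalars => @complex.Re R
  end.

(* The norm of a normed module over R[i] takes its values in R[i]; the axiom
   below is an equation in the scalar field. *)
Record hilbert (R : realType) (k : scalar_kind) := Hilbert {
  hilbert_sort :> completeNormedModType (scalar R k);
  hdot : {dot hilbert_sort for @scalar_conj R k};
  hilbert_normE : forall x : hilbert_sort, `|x| ^+ 2 = hdot x x }.

Arguments hdot {R k} h.

Definition form_norm (R : realType) (k : scalar_kind)
    (W : lmodType (scalar R k)) (b : W -> W -> scalar R k) (w : W) : R :=
  Num.sqrt (scalar_re (b w w)).

Definition supp (R : realType) (gamma : nat -> R) : set nat :=
  [set i | 0 < gamma i].

(* Since each R_i V_i is a linear subspace, the span of their union is the set
   of finite sums with one term per index. *)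
Definition splitting_span (R : realType) (k : scalar_kind) (V : hilbert R k)
    (Vi : nat -> hilbert R k) (Ri : forall i, {linear Vi i -> V})
    (S : set nat) : set V :=
  [set x | exists (I : {fset nat}) (v : forall i, Vi i),
     [set` I] `<=` S /\ x = \sum_(i <- I) Ri i (v i)].

(* Only 0 < q <= +oo is meaningful. *)
Definition lq_norm (R : realType) (q : \bar R) (I : {fset nat})
    (x : nat -> R) : R :=
  match q with
  | r%:E => (\sum_(i <- I) `|x i| `^ r) `^ r^-1
  | +oo%E => \big[Num.max/0]_(i <- I) `|x i|
  | -oo%E => 0
  end.

Definition A_norm (R : realType) (k : scalar_kind) (V : hilbert R k)
    (Vi : nat -> hilbert R k) (Ri : forall i, {linear Vi i -> V})
    (gamma : nat -> R) (q : \bar R) (x : V) : R :=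
  inf [set N | exists (I : {fset nat}) (v : forall i, Vi i),
    [/\ [set` I] `<=` supp gamma,
        x = \sum_(i <- I) Ri i (v i) &
        N = lq_norm q I
              (fun i => (gamma i)^-1 * form_norm (hdot (Vi i)) (v i))]].

(* Elements of the completion are given by Cauchy sequences of the span; the
   norm and the image in V_a defined below take the same value on sequences
   whose difference tends to 0 in the norm A_norm. *)
Record A_space (R : realType) (k : scalar_kind) (V : hilbert R k)
    (Vi : nat -> hilbert R k) (Ri : forall i, {linear Vi i -> V})
    (gamma : nat -> R) (q : \bar R) := ASpace {
  A_seq :> nat -> V;
  A_seq_span : forall n, splitting_span Ri (supp gamma) (A_seq n);
  A_seq_cauchy : forall e : R, 0 < e -> exists N : nat, forall m n : nat,
    (N <= m)%N -> (N <= n)%N -> A_norm Ri gamma q (A_seq m - A_seq n) < e }.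

Definition A_space_norm (R : realType) (k : scalar_kind) (V : hilbert R k)
    (Vi : nat -> hilbert R k) (Ri : forall i, {linear Vi i -> V})
    (gamma : nat -> R) (q : \bar R) (x : A_space Ri gamma q) : R :=
  lim (A_norm Ri gamma q (x n) @[n --> \oo]).

(* u is the image of x under the continuous extension to the completion of the
   inclusion of the span into V_a. *)
Definition A_space_image (R : realType) (k : scalar_kind) (V : hilbert R k)
    (a : V -> V -> scalar R k)
    (Vi : nat -> hilbert R k) (Ri : forall i, {linear Vi i -> V})
    (gamma : nat -> R) (q : \bar R) (x : A_space Ri gamma q) (u : V) : Prop :=
  form_norm a (x n - u) @[n --> \oo] --> (0 : R).

Section schwarz.
Variables (R : realType) (k : scalar_kind) (V : hilbert R k).
Variables (a : V -> V -> scalar R k) (Vi : nat -> hilbert R k).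
Variables (Ri : forall i, {linear Vi i -> V}) (Ti : forall i, V -> Vi i).
Variable u : V.

Definition residual (w : V) (i : nat) : Vi i := Ti i (u - w).

Definition alpha (m : nat) : scalar R k := 1 - (m.+2)%:R^-1.

(* a z z is the square of the norm of z in V_a. When z = 0, division by zero
   yields 0, but then the value is irrelevant in schwarz_step. *)
Definition omega (m : nat) (w z : V) : scalar R k :=
  a (u - alpha m *: w) z / a z z.

Definition schwarz_step (m i : nat) (w : V) : V :=
  let z := Ri i (residual w i) in
  alpha m *: w + omega m w z *: z.

Fixpoint schwarz_iter (idx : nat -> nat) (m : nat) : V :=
  if m is m'.+1 then schwarz_step m' (idx m') (schwarz_iter idx m') else 0.

End schwarz.

Definition prob_distribution (R : realType) (pi : nat -> R) : Prop :=
  (forall i, 0 <= pi i) /\ (\sum_(0 <= i <oo) (pi i)%:E = 1)%E.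

Definition mutually_independent (d d' : measure_display)
    (Omega : measurableType d) (T : measurableType d') (R : realType)
    (P : probability Omega R) (X : nat -> {RV P >-> T}) : Prop :=
  forall (J : {fset nat}) (B : nat -> set T),
    (forall j, measurable (B j)) ->
    P (\bigcap_(j in [set` J]) (X j @^-1` B j)) =
      (\prod_(j <- J) P (X j @^-1` B j))%E.

(* Main.v *)
From HB Require Import structures.
Require Import Defs.
From mathcomp Require Import ring lra measurable_realfun ess_sup_inf.

Set Implicit Arguments.
Unset Strict Implicit.
Unset Printing Implicit Defensive.

Import Order.TTheory GRing.Theory Num.Theory.
Import numFieldNormedType.Exports.

Local Open Scope classical_set_scope.
Local Open Scope ring_scope.

(** Write [e = u - u^(m)], [s = 1/(m+2)], [rho_i = ||T_i e||] and
    [h_i = R_i T_i e / rho_i], so that [a(e, h_i) = rho_i] and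
    [||h_i|| <= Lambda].  Since [u - alpha_m u^(m) = (1 - s) e + s u] and
    [omega_m] is optimal, the correction of the method is at least as good as
    [s N h_i], for every real [N]; expanding the square gives
      [||e'||^2 <= (1-s)^2 ||e||^2 + 2 s (1-s) (Re a(e,u) - N rho_i)
                   + 2 s^2 (||u||^2 + Lambda^2 N^2)].
    A decomposition [u = sum_j R_j v_j] yields
    [Re a(e,u) <= sum_j rho_j ||v_j||], which is at most
    [(sup_j rho_j) ||u||_{A_1}] and at most
    [(sum_j pi_j rho_j) ||u||_{A_oo^pi}].  The cross term is therefore
    nonpositive for the greedy choice with [N = ||u||_{A_1} / beta], and
    nonpositive on average over [i] with [N = ||u||_{A_oo^pi}] for the random
    one.  The recursion [x_(m+1) <= (1-s)^2 x_m + s^2 C] then keeps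
    [x_m <= C / (m+1)]. *)

(** * Positive Hermitian forms *)

Section scalars.
Variables (R : realType) (k : scalar_kind).
Implicit Types (c : scalar R k) (t : R).

Definition real_scalar : {rmorphism R -> scalar R k} :=
  match k with RealScalars => idfun | ComplexScalars => @real_complex R end.

Lemma scalar_re_is_zmod_morphism : zmod_morphism (@scalar_re R k).
Proof. by case: k => //= -[? ?] [? ?]. Qed.

HB.instance Definition _ :=
  GRing.isZmodMorphism.Build (scalar R k) R (@scalar_re R k)
    scalar_re_is_zmod_morphism.

Lemma scalar_re_conj c : scalar_re (scalar_conj R k c) = scalar_re c.
Proof. by case: k c => //= -[]. Qed.

Lemma scalar_conj_real t : scalar_conj R k (real_scalar t) = real_scalar t.
Proof. by rewrite /real_scalar; case: k => //=; rewrite oppr0. Qed.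

Lemma scalar_re_realM t c : scalar_re (real_scalar t * c) = t * scalar_re c.
Proof.
rewrite /real_scalar; case: k c => //= -[x y] /=.
by rewrite mul0r subr0.
Qed.

Lemma scalar_re_ge0 c : 0 <= c -> 0 <= scalar_re c.
Proof. by case: k c => //= c; rewrite lecE => /andP[]. Qed.

End scalars.

Section positive_forms.
Variables (R : realType) (k : scalar_kind) (W : lmodType (scalar R k)).
Variable b : {hermitian_sym W for @scalar_conj R k}.
Hypothesis b_ge0 : forall x, 0 <= b x x.
Implicit Types (x y z : W) (c : scalar R k) (t : R).

Local Notation "`| x |_b" := (form_norm b x) (format "`| x |_b").

Definition re_form x y : R := scalar_re (b x y).

Lemma re_formC x y : re_form x y = re_form y x.
Proof. by rewrite /re_form hermC expr0 mul1r scalar_re_conj. Qed.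

Lemma re_form_is_zmod_morphism x : zmod_morphism (re_form x).
Proof. by move=> y z; rewrite /re_form linearBr raddfB. Qed.

HB.instance Definition _ x :=
  GRing.isZmodMorphism.Build W R (re_form x) (re_form_is_zmod_morphism x).

Lemma re_formZr t x y : re_form x (real_scalar R k t *: y) = t * re_form x y.
Proof. by rewrite /re_form linearZr_LR /= scalar_conj_real scalar_re_realM. Qed.

Lemma re_formZl t x y : re_form (real_scalar R k t *: x) y = t * re_form x y.
Proof. by rewrite re_formC re_formZr re_formC. Qed.

Lemma re_form_ge0 x : 0 <= re_form x x.
Proof. exact: scalar_re_ge0. Qed.

Lemma form_norm_ge0 x : 0 <= `|x|_b.
Proof. exact: sqrtr_ge0. Qed.

Lemma form_norm0 : `|0|_b = 0.
Proof. by rewrite /form_norm linear0l raddf0 sqrtr0. Qed.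

Lemma form_normN x : `|- x|_b = `|x|_b.
Proof. by rewrite /form_norm linearNl linearNr opprK. Qed.

Lemma sqr_form_norm x : `|x|_b ^+ 2 = re_form x x.
Proof. by rewrite sqr_sqrtr// re_form_ge0. Qed.

Lemma sqr_form_normZ t x :
  `|real_scalar R k t *: x|_b ^+ 2 = t ^+ 2 * `|x|_b ^+ 2.
Proof. by rewrite !sqr_form_norm re_formZl re_formZr mulrA. Qed.

Lemma sqr_form_normD x y :
  `|x + y|_b ^+ 2 = `|x|_b ^+ 2 + 2 * re_form x y + `|y|_b ^+ 2.
Proof.
rewrite !sqr_form_norm raddfD /= 2![re_form (x + y) _]re_formC !raddfD /=.
rewrite [re_form y x]re_formC; ring.
Qed.

Lemma sqr_form_normB_le x y :
  `|x - y|_b ^+ 2 <= 2 * (`|x|_b ^+ 2 + `|y|_b ^+ 2).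
Proof.
have := sqr_ge0 `|x + y|_b; rewrite !sqr_form_normD form_normN raddfN /=; lra.
Qed.

(* The polynomial [t |-> |x + t y|^2] has a nonpositive discriminant. *)
Lemma sqr_re_form_le x y : re_form x y ^+ 2 <= `|x|_b ^+ 2 * `|y|_b ^+ 2.
Proof.
pose p := Poly [:: `|x|_b ^+ 2; 2 * re_form x y; `|y|_b ^+ 2].
suff: p`_1 ^+ 2 - 4 * p`_2 * p`_0 <= 0 by rewrite !coefE /=; lra.
apply: deg_le2_poly_ge0 => [|t]; first exact: size_Poly.
have := sqr_ge0 `|x + real_scalar R k t *: y|_b.
by rewrite sqr_form_normD sqr_form_normZ re_formZr horner_Poly /=; lra.
Qed.

Lemma normr_re_form_le x y : `|re_form x y| <= `|x|_b * `|y|_b.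
Proof.
rewrite -ler_sqr ?nnegrE ?mulr_ge0 ?form_norm_ge0// real_normK ?num_real//.
by rewrite exprMn sqr_re_form_le.
Qed.

Lemma re_form_le x y : re_form x y <= `|x|_b * `|y|_b.
Proof. exact: le_trans (ler_norm _) (normr_re_form_le _ _). Qed.

Lemma form_normD x y : `|x + y|_b <= `|x|_b + `|y|_b.
Proof.
rewrite -ler_sqr ?nnegrE ?addr_ge0 ?form_norm_ge0// sqr_form_normD.
have := re_form_le x y; lra.
Qed.

Lemma re_form_projection_orthogonal x z c :
  re_form (x - (b x z / b z z) *: z) (c *: z) = 0.
Proof.
have [bzz0|bzz_neq0] := eqVneq (b z z) 0.
  have z0 : `|c *: z|_b = 0.
    by rewrite /form_norm linearZl_LR linearZr_LR /= bzz0 !mulr0 raddf0 sqrtr0.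
  apply/eqP; rewrite -normr_le0 (le_trans (normr_re_form_le _ _))//.
  by rewrite z0 mulr0.
rewrite /re_form linearZr_LR /= linearBl linearZl_LR /= divfK// subrr mulr0.
exact: raddf0.
Qed.

Lemma form_norm_projection_le x z c :
  `|x - (b x z / b z z) *: z|_b <= `|x - c *: z|_b.
Proof.
rewrite -ler_sqr ?nnegrE ?form_norm_ge0//.
have -> : x - c *: z = x - (b x z / b z z) *: z + (b x z / b z z - c) *: z.
  by rewrite scalerBl addrA subrK.
rewrite [leRHS]sqr_form_normD re_form_projection_orthogonal mulr0 addr0.
by rewrite lerDl sqr_ge0.
Qed.

End positive_forms.

Lemma hdot_ge0 (R : realType) (k : scalar_kind) (W : hilbert R k) (w : W) :
  0 <= hdot W w w.
Proof. by rewrite -hilbert_normE exprn_ge0. Qed.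

(** * Approximation spaces *)

Definition extend0 (T : nat -> nmodType) (I : {fset nat}) (v : forall i, T i)
    (i : nat) : T i :=
  if i \in I then v i else 0.

Lemma ae_countingP (d : measure_display) (T : measurableType d) (R : realType)
    (Q : T -> Prop) :
  (\forall x \ae (@counting T R), Q x) <-> forall x, Q x.
Proof.
split=> [[A [_ countA0 QA]] x|]; last exact: aeW.
apply: contrapT => /QA Ax; move: countA0; rewrite /= /counting.
case: asboolP => // finA [] /eqP; rewrite pnatr_eq0 cardfs_eq0 => /eqP A0.
by move: Ax; rewrite -(fset_setK finA) A0.
Qed.

Section lq_norm.
Variable R : realType.
Implicit Types (q : \bar R) (I J : {fset nat}) (f g : nat -> R).

Local Notation counting_nat := (@counting nat R).

Lemma le_lq_normy I f i : i \in I -> `|f i| <= lq_norm +oo I f.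
Proof.
move=> iI; exact: (le_bigmax_seq 0 i xpredT (fun j => `|f j|) iI isT).
Qed.

Lemma EFin_lq_norm q I f : (0 < q)%E ->
  (lq_norm q I f)%:E = ('N[counting_nat]_q [EFin \o extend0 I f])%E.
Proof.
case: q => [r r_gt0|_|]//.
  rewrite Lnorm_counting// nneseries_esumT => [|i]; last exact: poweR_ge0.
  rewrite (_ : \esum_(i in _) _ = \esum_(i in [set` I]) (`|f i| `^ r)%:E)%E.
    rewrite esum_fset// -(fsbig_seq _ _ (fset_uniq I)).
    by rewrite sumEFin poweR_EFin.
  rewrite [RHS]esum_mkcond; apply: eq_esum => i _.
  rewrite /extend0 mem_setE /=; case: ifP => // _.
  by rewrite normr0 powR0// gt_eqF.
rewrite unlock ifT; last first.
  by rewrite /= /counting asboolF//; exact: infinite_nat.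
apply/eqP; rewrite eq_le; apply/andP; split.
  set M := leRHS; have le_M : forall i, (`|extend0 I f i|%:E <= M)%E.
    by apply/ae_countingP; exact: ess_sup_ge.
  move: M le_M => [M| |] le_M; [|exact: leey|by have := le_M 0%N].
  rewrite lee_fin /= big_seq; apply/bigmax_le => [|i iI].
    by rewrite -lee_fin; apply: le_trans (le_M 0%N); rewrite lee_fin.
  by rewrite -lee_fin; have := le_M i; rewrite /extend0 iI.
apply/ess_supP/ae_countingP => i; rewrite lee_fin /extend0.
case: ifP => [/le_lq_normy -> //|_]; rewrite normr0; exact: bigmax_ge_id.
Qed.

Lemma lq_norm_ge0 q I f : 0 <= lq_norm q I f.
Proof. by case: q => [r| |] //=; [exact: powR_ge0|exact: bigmax_ge_id]. Qed.

Lemma lq_normD q I f g : (1 <= q)%E ->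
  lq_norm q I (f \+ g) <= lq_norm q I f + lq_norm q I g.
Proof.
move=> q_ge1; have q_gt0 : (0 < q)%E := lt_le_trans lte01 q_ge1.
rewrite -lee_fin EFinD !EFin_lq_norm//.
have ext0D : EFin \o extend0 I (f \+ g) = EFin \o (extend0 I f \+ extend0 I g).
  by apply/funext => i /=; rewrite /extend0; case: ifP => // _; rewrite addr0.
by rewrite ext0D eminkowski.
Qed.

Lemma le_lq_norm q I f g : (0 < q)%E -> (forall i, `|f i| <= `|g i|) ->
  lq_norm q I f <= lq_norm q I g.
Proof.
case: q => [r|_|//] => [|fg]; last first.
  rewrite /= big_seq; apply/bigmax_le => [|i iI]; first exact: bigmax_ge_id.
  exact: le_trans (fg i) (le_lq_normy _ iI).
rewrite lte_fin => /ltW r_ge0 fg.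
have sum_ge0 h : 0 <= \sum_(i <- I) `|h i| `^ r.
  by rewrite sumr_ge0// => i _; exact: powR_ge0.
rewrite ge0_ler_powR ?nnegrE ?invr_ge0//.
by apply: ler_sum => i _; rewrite ge0_ler_powR ?nnegrE.
Qed.

Lemma lq_norm_extend0 q I J f : (0 < q)%E -> (I `<=` J)%fset ->
  lq_norm q J (extend0 I f) = lq_norm q I f.
Proof.
move=> q_gt0 /fsubsetP IJ; apply: EFin_inj; rewrite !EFin_lq_norm//.
apply: eq_Lnorm => i; rewrite /extend0 /=.
by case: (boolP (i \in I)) => [/IJ ->//|_]; case: ifP.
Qed.

Lemma lq_norm1 I f : lq_norm 1 I f = \sum_(i <- I) `|f i|.
Proof.
rewrite /= invr1 powRr1; last by rewrite sumr_ge0// => i _; exact: powR_ge0.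
by apply: eq_bigr => i _; rewrite powRr1.
Qed.

End lq_norm.

Section approximation_spaces.
Variables (R : realType) (k : scalar_kind) (V : hilbert R k).
Variables (Vi : nat -> hilbert R k) (Ri : forall i, {linear Vi i -> V}).
Variables (gamma : nat -> R) (q : \bar R).
Hypothesis q_ge1 : (1 <= q)%E.
Implicit Types (x y : V) (I J : {fset nat}) (v w : forall i, Vi i).

Let q_gt0 : (0 < q)%E := lt_le_trans lte01 q_ge1.

Definition splitting_sum I v : V := \sum_(i <- I) Ri i (v i).

Definition weighted_norm v i : R :=
  (gamma i)^-1 * form_norm (hdot (Vi i)) (v i).

Lemma splitting_sum_extend0 I J v : (I `<=` J)%fset ->
  splitting_sum J (extend0 I v) = splitting_sum I v.
Proof.
move=> IJ; rewrite /splitting_sum -(big_fset_incl _ IJ).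
  by rewrite big_seq [RHS]big_seq; apply: eq_bigr => i iI; rewrite /extend0 iI.
by move=> i _ iI; rewrite /extend0 (negbTE iI) raddf0.
Qed.

Lemma weighted_norm_extend0 I v :
  weighted_norm (extend0 I v) = extend0 I (weighted_norm v).
Proof.
apply/funext => i; rewrite /weighted_norm /extend0; case: ifP => // _.
by rewrite form_norm0 mulr0.
Qed.

Lemma lq_weighted_normD I v w :
  lq_norm q I (weighted_norm (fun i => v i + w i)) <=
  lq_norm q I (weighted_norm v) + lq_norm q I (weighted_norm w).
Proof.
apply: le_trans (lq_normD _ _ _ q_ge1); apply: le_lq_norm => // i.
have norm_ge0 (z : Vi i) := form_norm_ge0 (hdot (Vi i)) z.
rewrite /weighted_norm /= -mulrDr !normrM ler_wpM2l// !ger0_norm ?addr_ge0//.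
exact: form_normD (@hdot_ge0 _ _ _) _ _.
Qed.

Lemma splitting_spanB (S : set nat) x y : splitting_span Ri S x ->
  splitting_span Ri S y -> splitting_span Ri S (x - y).
Proof.
move=> [I [v [IS ->]]] [J [w [JS ->]]].
exists (I `|` J)%fset, (fun i => extend0 I v i - extend0 J w i); split.
  by move=> i /=; rewrite in_fsetU => /orP[/IS|/JS].
under [RHS]eq_bigr do rewrite raddfB.
rewrite sumrB -!/(splitting_sum _ _).
by rewrite !splitting_sum_extend0 ?fsubsetUl ?fsubsetUr.
Qed.

Lemma A_norm_le I v : [set` I] `<=` supp gamma ->
  A_norm Ri gamma q (splitting_sum I v) <= lq_norm q I (weighted_norm v).
Proof.
move=> Igamma; apply: ge_inf; last by exists I, v.
by exists 0 => _ [J [w [_ _ ->]]]; exact: lq_norm_ge0.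
Qed.

Lemma le_A_norm x r : splitting_span Ri (supp gamma) x ->
  (forall I v, [set` I] `<=` supp gamma -> x = splitting_sum I v ->
     r <= lq_norm q I (weighted_norm v)) ->
  r <= A_norm Ri gamma q x.
Proof.
move=> [I [v [Igamma xE]]] r_le; apply: lb_le_inf.
  by exists (lq_norm q I (weighted_norm v)), I, v.
by move=> _ [J [w [Jgamma xE' ->]]]; exact: r_le.
Qed.

Lemma A_norm_ge0 x : splitting_span Ri (supp gamma) x ->
  0 <= A_norm Ri gamma q x.
Proof.
by move=> x_span; apply: le_A_norm => // I v _ _; exact: lq_norm_ge0.
Qed.

Lemma A_normD x y :
  splitting_span Ri (supp gamma) x -> splitting_span Ri (supp gamma) y ->
  A_norm Ri gamma q (x + y) <= A_norm Ri gamma q x + A_norm Ri gamma q y.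
Proof.
move=> x_span y_span; rewrite -lerBlDr; apply: le_A_norm => // I v Igamma xE.
rewrite lerBlDr -lerBlDl; apply: le_A_norm => // J w Jgamma yE.
rewrite lerBlDl; pose K := (I `|` J)%fset.
have IK : (I `<=` K)%fset := fsubsetUl I J.
have JK : (J `<=` K)%fset := fsubsetUr I J.
have -> : x + y = splitting_sum K (fun i => extend0 I v i + extend0 J w i).
  rewrite /splitting_sum; under eq_bigr do rewrite raddfD.
  by rewrite big_split -!/(splitting_sum _ _) !splitting_sum_extend0// xE yE.
apply: le_trans (A_norm_le _ _) _.
  by move=> i /=; rewrite in_fsetU => /orP[/Igamma|/Jgamma].
apply: le_trans (lq_weighted_normD _ _ _) _.
by rewrite !weighted_norm_extend0 !lq_norm_extend0.
Qed.

Lemma is_cvg_A_norm (x : A_space Ri gamma q) :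
  cvg (A_norm Ri gamma q (x n) @[n --> \oo]).
Proof.
have le_A_normB m n : A_norm Ri gamma q (x m) - A_norm Ri gamma q (x n) <=
    A_norm Ri gamma q (x m - x n).
  rewrite lerBlDr -{1}[x m](subrK (x n)) A_normD//; last exact: A_seq_span.
  by apply: splitting_spanB; exact: A_seq_span.
apply/cauchy_cvgP/cauchy_ballP => e e0; near_simpl.
have [N cauchyN] := A_seq_cauchy x e0.
near=> m n.
have mN : (N <= m)%N by near: m; exact: nbhs_infty_ge.
have nN : (N <= n)%N by near: n; exact: nbhs_infty_ge.
rewrite /ball /= ltr_norml ltrNl opprB.
by rewrite !(le_lt_trans (le_A_normB _ _))// cauchyN.
Unshelve. all: end_near. Qed.

Lemma A_space_norm_ge0 (x : A_space Ri gamma q) : 0 <= A_space_norm x.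
Proof.
apply: limr_ge; first exact: is_cvg_A_norm.
by near=> n; apply: A_norm_ge0; exact: A_seq_span.
Unshelve. all: end_near. Qed.

Section representable_functional.
Variable a : {hermitian_sym V for @scalar_conj R k}.
Hypothesis a_ge0 : forall y, 0 <= a y y.
Variables (e : V) (M : R).
Hypothesis M_ge0 : 0 <= M.
Hypothesis re_form_le_lq_norm : forall I v, [set` I] `<=` supp gamma ->
  re_form a e (splitting_sum I v) <= M * lq_norm q I (weighted_norm v).

Lemma re_form_le_A_norm x : splitting_span Ri (supp gamma) x ->
  re_form a e x <= M * A_norm Ri gamma q x.
Proof.
move=> x_span; have [I [v [Igamma xE]]] := x_span.
have := M_ge0; rewrite le_eqVlt => /predU1P[M0|M_gt0].
  have := re_form_le_lq_norm v Igamma.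
  by rewrite /splitting_sum -xE -M0 !mul0r.
rewrite -ler_pdivrMl//; apply: le_A_norm => // J w Jgamma ->.
by rewrite ler_pdivrMl// re_form_le_lq_norm.
Qed.

Lemma re_form_le_A_space_norm (x : A_space Ri gamma q) (u : V) :
  A_space_image a x u -> re_form a e u <= M * A_space_norm x.
Proof.
move=> xu.
have bound_cvg :
    M * A_norm Ri gamma q (x n) + form_norm a e * form_norm a (x n - u)
    @[n --> \oo] --> M * A_space_norm x.
  rewrite -[X in _ --> X]addr0 -[X in _ --> _ + X](mulr0 (form_norm a e)).
  by apply: cvgD; apply: cvgM => //; try exact: cvg_cst; exact: is_cvg_A_norm.
rewrite -(cvg_lim _ bound_cvg)//; apply: limr_ge.
  by apply/cvg_ex; eexists; exact: bound_cvg.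
near=> n; have -> : re_form a e u = re_form a e (x n) - re_form a e (x n - u).
  by rewrite -raddfB /= subKr.
rewrite lerD ?re_form_le_A_norm//; first exact: A_seq_span.
by rewrite -raddfN (le_trans (re_form_le a_ge0 _ _))// form_normN.
Unshelve. all: end_near. Qed.

End representable_functional.

End approximation_spaces.

(** * Independent random variables *)

Section independence.
Context (d d1 d2 : measure_display) (Omega : measurableType d).
Context (T1 : measurableType d1) (T2 : measurableType d2) (R : realType).
Variable P : probability Omega R.
Variables (X : {RV P >-> T1}) (Y : {RV P >-> T2}).

Definition independent_rv : Prop := forall (A : set T1) (B : set T2),
  measurable A -> measurable B ->
  P (X @^-1` A `&` Y @^-1` B) = (P (X @^-1` A) * P (Y @^-1` B))%E.

Definition pair_rv (w : Omega) : T1 * T2 := (X w, Y w).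

Lemma measurable_pair_rv : measurable_fun [set: Omega] pair_rv.
Proof. exact: measurable_fun_pair. Qed.

HB.instance Definition _ :=
  isMeasurableFun.Build _ _ _ _ pair_rv measurable_pair_rv.

Lemma distribution_pair_rv : independent_rv ->
  forall C : set (T1 * T2), measurable C ->
  distribution P pair_rv C = (distribution P X \x distribution P Y)%E C.
Proof.
by move=> indepXY C mC; apply/esym/product_measure_unique.
Qed.

Lemma ge0_integral_independent_rv (g : T1 * T2 -> \bar R) : independent_rv ->
  measurable_fun [set: T1 * T2] g -> (forall z, 0 <= g z)%E ->
  (\int[P]_w g (X w, Y w) =
   \int[P]_w \int[distribution P Y]_y g (X w, y))%E.
Proof.
move=> indepXY mg g_ge0.
rewrite -(ge0_integral_distribution pair_rv)//.
rewrite (eq_measure_integral (distribution P X \x distribution P Y)%E);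
  last first.
  by move=> C mC _; exact: distribution_pair_rv.
rewrite fubini_tonelli1// (ge0_integral_distribution X)//.
  exact: measurable_fun_fubini_tonelli_F.
by move=> x; exact: integral_ge0.
Qed.

End independence.

Section independent_sequence.
Context (d d' : measure_display) (Omega : measurableType d).
Context (T : measurableType d') (R : realType).
Variables (P : probability Omega R) (X : nat -> {RV P >-> T}).

Lemma mutually_independent_fsetU1 (J : {fset nat}) (B : nat -> set T) j :
  mutually_independent X -> (forall i, measurable (B i)) -> j \notin J ->
  P (\bigcap_(i in [set` J]) (X i @^-1` B i) `&` X j @^-1` B j) =
  (P (\bigcap_(i in [set` J]) (X i @^-1` B i)) * P (X j @^-1` B j))%E.
Proof.
move=> indepX mB jJ; have := indepX (j |` J)%fset B mB.
by rewrite big_fsetU1//= -indepX// set_fsetU1 bigcap_setU1 setIC muleC.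
Qed.

Definition cylinder n (B : 'I_n -> set T) : set (n.-tuple T) :=
  \bigcap_i ((fun t => tnth t i) @^-1` B i).

Definition measurable_cylinders n : set (set (n.-tuple T)) :=
  [set cylinder B | B in [set B | forall i, measurable (B i)]].

Lemma setI_closed_measurable_cylinders n :
  setI_closed (@measurable_cylinders n).
Proof.
move=> _ _ [B mB <-] [C mC <-]; exists (fun i => B i `&` C i).
  by move=> i; exact: measurableI.
by rewrite /cylinder -bigcapI.
Qed.

Lemma measurable_tupleE n :
  @measurable _ (n.-tuple T) = <<s @measurable_cylinders n >>.
Proof.
apply/seteqP; split.
  apply: smallest_sub; first exact: smallest_sigma_algebra.
  move=> A; rewrite -bigcup_seq => -[i _ [B mB <-]].
  apply: sub_sigma_algebra; exists (fun j => if j == i then B else setT).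
    by move=> j; case: ifP.
  rewrite setTI; apply/seteqP; split=> t /= => [/(_ i I)|Bti j _ /=].
    by rewrite eqxx.
  by case: eqP => [->|].
apply: smallest_sub; first exact: sigma_algebra_measurable.
move=> _ [B mB <-]; apply: fin_bigcap_measurable => // i _.
rewrite -[X in measurable X]setTI; exact: measurable_tnth.
Qed.

Definition history m (w : Omega) : m.-tuple T := [tuple X i w | i < m].

Lemma measurable_history m : measurable_fun [set: Omega] (history m).
Proof.
apply/measurable_fun_tnthP => i.
rewrite (_ : _ \o _ = X i)//.
by apply/funext => w /=; rewrite tnth_mktuple.
Qed.

HB.instance Definition _ m :=
  isMeasurableFun.Build _ _ _ _ (history m) (@measurable_history m).

Lemma history_cylinder_independent m (B : 'I_m -> set T) (C : set T) :
  mutually_independent X -> (forall i, measurable (B i)) -> measurable C ->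
  P (history m @^-1` cylinder B `&` X m @^-1` C) =
  (P (history m @^-1` cylinder B) * P (X m @^-1` C))%E.
Proof.
move=> indepX mB mC.
pose D j := if insub j is Some i then B i else C.
have mD j : measurable (D j) by rewrite /D; case: insubP.
have Dm : D m = C by rewrite /D insubF// ltnn.
have -> : history m @^-1` cylinder B =
    \bigcap_(j in [set` [fset j in iota 0 m]%fset]) (X j @^-1` D j).
  apply/seteqP; split=> w wB.
    move=> j /=; rewrite !inE mem_iota add0n => /andP[_ jm].
    by have := wB (Ordinal jm) I; rewrite /= tnth_mktuple /D insubT.
  move=> i _ /=; rewrite tnth_mktuple.
  have := wB i; rewrite /= !inE mem_iota ltn_ord => /(_ isT).
  by rewrite /D valK.
by rewrite -Dm mutually_independent_fsetU1// !inE mem_iota add0n ltnn.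
Qed.

Lemma history_independent m :
  mutually_independent X -> independent_rv (history m) (X m).
Proof.
move=> indepX A C mA mC.
have mXC : measurable (X m @^-1` C).
  by rewrite -[X in measurable X]setTI; exact: measurable_funPT.
have PXC : P (X m @^-1` C) \is a fin_num by exact: fin_num_measure.
pose p := NngNum (fine_ge0 (measure_ge0 P (X m @^-1` C))).
pose joint := pushforward (mrestr P mXC) (history m).
pose product := mscale p (distribution P (history m)).
suff: joint A = product A.
  by rewrite /joint /product /mscale /pushforward /mrestr /= fineK// muleC.
apply: (measure_unique (@measurable_cylinders m) (fun=> setT)) => //.
- exact: measurable_tupleE.
- exact: setI_closed_measurable_cylinders.
- by exists (fun=> setT) => //; apply/seteqP; split.
- exact: bigcup_const.
- move=> _ [B mB <-]; rewrite /= /mscale /distribution /pushforward /mrestr /=.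
  by rewrite fineK// [RHS]muleC; exact: history_cylinder_independent.
- move=> _; rewrite /= /pushforward /mrestr preimage_setT setTI.
  by rewrite -ge0_fin_numE.
Qed.

End independent_sequence.

Lemma measurable_set1_tuple (d : measure_display) (T : measurableType d) n
    (t : n.-tuple T) :
  (forall x : T, measurable [set x]) -> measurable [set t].
Proof.
move=> m1; rewrite measurable_tupleE; apply: sub_sigma_algebra.
exists (fun i => [set tnth t i]) => //.
apply/seteqP; split=> s /= => [st|->//]; apply: eq_from_tnth => i; exact: st.
Qed.

Lemma measurable_fun_countable (d d' : measure_display) (T : measurableType d)
    (T' : measurableType d') (D : set T) (f : T -> T') :
  countable [set: T] -> (forall x : T, measurable [set x]) ->
  measurable_fun D f.
Proof.
move=> cT m1 mD B _; apply: countable_measurable => //.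
exact: sub_countable (subset_card_le (@subsetT _ _)) cT.
Qed.

Lemma sum_set1_le_integral (d : measure_display) (T : measurableType d)
    (R : realType) (mu : {measure set T -> \bar R}) (s : seq T)
    (f : T -> \bar R) :
  (forall x : T, measurable [set x]) -> uniq s ->
  measurable_fun [set: T] f -> (forall x, 0 <= f x)%E ->
  (\sum_(x <- s) f x * mu [set x] <= \int[mu]_x f x)%E.
Proof.
move=> m1 s_uniq mf f_ge0.
pose A := \big[setU/set0]_(x <- s) [set x].
have mA : measurable A by exact: bigsetU_measurable.
apply: (@le_trans _ _ (\int[mu]_(x in A) f x)%E); last first.
  exact: ge0_subset_integral.
rewrite ge0_integral_bigsetU//.
- apply: lee_sum => x _.
  rewrite (eq_integral (cst (f x))) ?integral_cst//.
  by move=> y; rewrite inE => ->.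
- by move=> x y _ _ [z [-> ->]].
- exact: measurable_funTS.
Qed.

Lemma integral_probability_le (d : measure_display) (T : measurableType d)
    (R : realType) (P : probability T R) (f : T -> \bar R) (M : R) :
  measurable_fun [set: T] f -> (forall x, 0 <= f x <= M%:E)%E ->
  (\int[P]_x f x <= M%:E)%E.
Proof.
move=> mf f_bound.
rewrite -[leRHS]mule1 -(@probability_setT _ _ _ P) -integral_cst//.
by apply: ge0_le_integral => // x _; have /andP[] := f_bound x.
Qed.

Lemma integral_probability_affine (d : measure_display) (T : measurableType d)
    (R : realType) (P : probability T R) (f : T -> \bar R) (b c : R) :
  measurable_fun [set: T] f -> (forall x, 0 <= f x)%E -> 0 <= b -> 0 <= c ->
  (\int[P]_x (b%:E * f x + c%:E) = b%:E * \int[P]_x f x + c%:E)%E.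
Proof.
move=> mf f_ge0 b_ge0 c_ge0; rewrite ge0_integralD//; last 2 first.
- by move=> x _; rewrite mule_ge0.
- exact: measurable_funeM.
by have := expectation_cst P c; rewrite unlock ge0_integralZl// => ->.
Qed.

(** * Convergence of the Schwarz iteration *)

Lemma harmonic_decay (R : realType) (x : nat -> \bar R) (C : R) :
  (x 0%N <= C%:E)%E ->
  (forall m, x m.+1 <= ((1 - m.+2%:R^-1) ^+ 2)%:E * x m +
                       (m.+2%:R^-1 ^+ 2 * C)%:E)%E ->
  forall m, (x m <= (C / m.+1%:R)%:E)%E.
Proof.
move=> x0 x_rec; elim=> [|m IHm]; first by rewrite invr1 mulr1.
apply: le_trans (x_rec m) _.
apply: (@le_trans _ _ (((1 - m.+2%:R^-1) ^+ 2)%:E * (C / m.+1%:R)%:E +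
                       (m.+2%:R^-1 ^+ 2 * C)%:E)%E).
  by rewrite leeD2r// lee_wpmul2l// lee_fin sqr_ge0.
rewrite -EFinM -EFinD lee_fin le_eqVlt; apply/predU1P; left.
by rewrite -[m.+2%:R]natr1; field; rewrite nat1r natr1 !pnatr_eq0.
Qed.

Section schwarz_iteration.
Variables (R : realType) (k : scalar_kind) (V : hilbert R k).
Variable a : {hermitian_sym V for @scalar_conj R k}.
Local Notation "`| x |_a" := (form_norm a x) (format "`| x |_a").
Hypothesis a_ge0 : forall v, 0 <= a v v.
Variables (Vi : nat -> hilbert R k) (Ri : forall i, {linear Vi i -> V}).
Variable Lambda : R.
Hypothesis Ri_bounded : forall (i : nat) (w : Vi i),
  `|Ri i w|_a <= Lambda * form_norm (hdot (Vi i)) w.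
Variable Ti : forall i, V -> Vi i.
Hypothesis Ti_def : forall (i : nat) (v : V) (w : Vi i),
  hdot (Vi i) (Ti i v) w = a v (Ri i w).
Variable u : V.
Implicit Types (e : V) (i m : nat) (N : R).

Definition residual_norm e i : R := form_norm (hdot (Vi i)) (Ti i e).

(* A vanishing residual gives the zero vector, since [0^-1 = 0]; the lemmas
   [re_form_search_direction] and [sqr_search_direction_le] still hold then. *)
Definition search_direction e i : V :=
  real_scalar R k (residual_norm e i)^-1 *: Ri i (Ti i e).

Lemma residual_norm_ge0 e i : 0 <= residual_norm e i.
Proof. exact: form_norm_ge0. Qed.

Lemma sqr_residual_norm e i :
  residual_norm e i ^+ 2 = scalar_re (hdot (Vi i) (Ti i e) (Ti i e)).
Proof. exact: sqr_form_norm (@hdot_ge0 _ _ _) _. Qed.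

Lemma re_form_search_direction e i :
  re_form a e (search_direction e i) = residual_norm e i.
Proof.
rewrite re_formZr /re_form -Ti_def -sqr_residual_norm expr2.
have [->|rho_neq0] := eqVneq (residual_norm e i) 0; first by rewrite !mulr0.
by rewrite mulKf.
Qed.

Lemma sqr_search_direction_le e i :
  `|search_direction e i|_a ^+ 2 <= Lambda ^+ 2.
Proof.
rewrite sqr_form_normZ//.
have [->|rho_neq0] := eqVneq (residual_norm e i) 0.
  by rewrite invr0 expr0n mul0r sqr_ge0.
have rho_gt0 : 0 < residual_norm e i by rewrite lt0r rho_neq0 residual_norm_ge0.
rewrite exprVn ler_pdivrMl ?exprn_gt0// -exprMn mulrC.
rewrite ler_sqr ?nnegrE ?form_norm_ge0 ?Ri_bounded//.
exact: le_trans (form_norm_ge0 _ _) (Ri_bounded _).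
Qed.

Lemma residual_norm_le e i : residual_norm e i <= `|e|_a * `|Lambda|.
Proof.
rewrite -re_form_search_direction (le_trans (re_form_le a_ge0 _ _))//.
rewrite ler_wpM2l ?form_norm_ge0// -ler_sqr ?nnegrE ?form_norm_ge0//.
by rewrite real_normK ?num_real// sqr_search_direction_le.
Qed.

Lemma re_form_splitting_sum_le e (I : {fset nat}) (v : forall i, Vi i) :
  re_form a e (splitting_sum Ri I v) <=
  \sum_(i <- I) residual_norm e i * form_norm (hdot (Vi i)) (v i).
Proof.
rewrite /splitting_sum raddf_sum ler_sum// => i _.
rewrite /= /re_form -Ti_def; exact: re_form_le (@hdot_ge0 _ _ _) _ _.
Qed.

Definition schwarz_constant N : R :=
  2 * (`|u|_a ^+ 2 + Lambda ^+ 2 * N ^+ 2).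

Lemma schwarz_constant_ge0 N : 0 <= schwarz_constant N.
Proof. by rewrite mulr_ge0// addr_ge0 ?sqr_ge0// -exprMn sqr_ge0. Qed.

Lemma sqr_solution_le_schwarz_constant N : `|u|_a ^+ 2 <= schwarz_constant N.
Proof.
have := sqr_ge0 `|u|_a; have := sqr_ge0 (Lambda * N).
rewrite exprMn /schwarz_constant; lra.
Qed.

Lemma sqr_solution_sub_search_direction_le N e i :
  `|u - real_scalar R k N *: search_direction e i|_a ^+ 2 <=
  schwarz_constant N.
Proof.
apply: (le_trans (sqr_form_normB_le a_ge0 _ _)).
rewrite ler_pM2l// lerD2l sqr_form_normZ// mulrC.
by rewrite ler_wpM2r ?sqr_ge0 ?sqr_search_direction_le.
Qed.

Lemma solution_sub_alphaZ m w (s := real_scalar R k m.+2%:R^-1) :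
  u - alpha R k m *: w = (1 - s) *: (u - w) + s *: u.
Proof.
have -> : alpha R k m = 1 - s by rewrite /alpha /s fmorphV rmorph_nat.
by rewrite scalerBr addrAC -scalerDl subrK scale1r.
Qed.

(* The optimal correction is compared with the multiple of the search direction
   that moves [s u] to [s (u - N h)]. *)
Lemma schwarz_step_error_le m w i N (s : R := m.+2%:R^-1) :
  `|u - schwarz_step a Ri Ti u m i w|_a <=
  `|real_scalar R k (1 - s) *: (u - w) +
    real_scalar R k s *:
      (u - real_scalar R k N *: search_direction (u - w) i)|_a.
Proof.
rewrite /schwarz_step /omega /residual; set z := Ri i _.
rewrite opprD addrA (le_trans (form_norm_projection_le a_ge0 _ _
  (real_scalar R k (s * N * (residual_norm (u - w) i)^-1))))//.
rewrite solution_sub_alphaZ /search_direction -/z.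
rewrite [X in _ <= form_norm _ (_ + X)]scalerBr.
by rewrite !scalerA -!rmorphM mulrA rmorphB rmorph1 addrA.
Qed.

Lemma sqr_schwarz_step_error_le m w i N (e := u - w) (s : R := m.+2%:R^-1) :
  `|u - schwarz_step a Ri Ti u m i w|_a ^+ 2 <=
    (1 - s) ^+ 2 * `|e|_a ^+ 2
    + 2 * (1 - s) * s * (re_form a e u - N * residual_norm e i)
    + s ^+ 2 * schwarz_constant N.
Proof.
have step_le := schwarz_step_error_le m w i N.
apply: le_trans (lerXn2r 2 _ _ step_le) _; rewrite ?nnegrE ?form_norm_ge0//.
rewrite -/e -/s; set y := u - _.
have re_ey : re_form a e y = re_form a e u - N * residual_norm e i.
  by rewrite /y raddfB /= re_formZr re_form_search_direction.
rewrite sqr_form_normD// !sqr_form_normZ// re_formZl re_formZr re_ey.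
apply: lerD; last first.
  by rewrite ler_wpM2l ?sqr_ge0 ?sqr_solution_sub_search_direction_le.
by rewrite lerD2l le_eqVlt; apply/predU1P; left; ring.
Qed.

Local Notation iterate := (schwarz_iter a Ri Ti u).

Definition sqr_error (idx : nat -> nat) m : R :=
  `|u - iterate idx m|_a ^+ 2.

Lemma eq_schwarz_iter (idx idx' : nat -> nat) m :
  (forall j, (j < m)%N -> idx j = idx' j) ->
  iterate idx m = iterate idx' m.
Proof.
elim: m => //= m IHm idxE; rewrite idxE// IHm// => j jm.
by rewrite idxE// ltnS ltnW.
Qed.

Section greedy_ordering.
Variable x : A_space Ri (fun=> 1) 1%:E.
Hypothesis xu : A_space_image a x u.

Lemma re_form_le_sup_residual e (S : R) : (forall i, residual_norm e i <= S) ->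
  re_form a e u <= S * A_space_norm x.
Proof.
move=> rho_le; apply: re_form_le_A_space_norm xu => //.
  exact: le_trans (residual_norm_ge0 e 0) (rho_le 0%N).
move=> I v _; rewrite lq_norm1 (le_trans (re_form_splitting_sum_le _ _ _))//.
rewrite mulr_sumr ler_sum// => i _.
by rewrite /weighted_norm invr1 mul1r ger0_norm ?ler_wpM2r ?form_norm_ge0.
Qed.

Variables (beta : R) (idx : nat -> nat).
Hypothesis beta_gt0 : 0 < beta.

Hypothesis idx_greedy : forall m : nat,
  let r := residual Ti u (iterate idx m) in
  ((beta ^+ 2)%:E *
     ereal_sup (range (fun i : nat =>
       (scalar_re (hdot (Vi i) (r i) (r i)))%:E))
   <= (scalar_re (hdot (Vi (idx m)) (r (idx m)) (r (idx m))))%:E)%E.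

Lemma greedy_residual_norm_le m i :
  residual_norm (u - iterate idx m) i <=
  residual_norm (u - iterate idx m) (idx m) / beta.
Proof.
have beta_ge0 := ltW beta_gt0.
rewrite ler_pdivlMr// mulrC -ler_sqr ?nnegrE ?mulr_ge0 ?residual_norm_ge0//.
rewrite exprMn !sqr_residual_norm -lee_fin; apply: le_trans (idx_greedy m).
rewrite EFinM lee_pmul2l ?lte_fin ?exprn_gt0//.
by apply: ereal_sup_ubound; exists i.
Qed.

Lemma greedy_sqr_error_le m :
  sqr_error idx m <= schwarz_constant (A_space_norm x / beta) / m.+1%:R.
Proof.
rewrite -lee_fin; move: m; apply: harmonic_decay => [|m].
  by rewrite /sqr_error subr0 lee_fin sqr_solution_le_schwarz_constant.
rewrite -EFinM -EFinD lee_fin.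
apply: le_trans (sqr_schwarz_step_error_le m _ _ (A_space_norm x / beta)) _.
rewrite lerD2r gerDl mulr_ge0_le0 ?subr_le0//.
  by rewrite !mulr_ge0 ?invr_ge0 ?subr_ge0 ?invf_le1 ?ler1n.
rewrite mulrAC -mulrA mulrC.
exact/re_form_le_sup_residual/greedy_residual_norm_le.
Qed.

End greedy_ordering.

Section random_ordering.
Variables (pi : nat -> R) (x : A_space Ri pi +oo%E).
Hypothesis xu : A_space_image a x u.

Local Notation C := (schwarz_constant (A_space_norm x)).

Section random_step.
Variable mu : probability nat R.
Hypothesis mu_pi : forall i, mu [set i] = (pi i)%:E.

Definition mean_residual_norm e : \bar R :=
  (\int[mu]_i (residual_norm e i)%:E)%E.

Lemma mean_residual_norm_fin_num e : mean_residual_norm e \is a fin_num.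
Proof.
rewrite ge0_fin_numE; last first.
  by apply: integral_ge0 => i _; rewrite lee_fin residual_norm_ge0.
apply: le_lt_trans (ltry (`|e|_a * `|Lambda|)).
apply: integral_probability_le => // i.
by rewrite !lee_fin residual_norm_ge0 residual_norm_le.
Qed.

Lemma re_form_le_mean_residual_norm e :
  re_form a e u <= fine (mean_residual_norm e) * A_space_norm x.
Proof.
apply: re_form_le_A_space_norm xu => //; first exact: leey.
  rewrite fine_ge0// integral_ge0// => i _.
  by rewrite lee_fin residual_norm_ge0.
move=> I v Ipi; set M := lq_norm _ _ _.
apply: le_trans (re_form_splitting_sum_le _ _ _) _.
apply: (@le_trans _ _ ((\sum_(i <- I) residual_norm e i * pi i) * M)).
  rewrite mulr_suml big_seq [leRHS]big_seq ler_sum// => i iI.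
  rewrite -mulrA ler_wpM2l ?residual_norm_ge0// -ler_pdivrMl; last exact: Ipi.
  by rewrite (le_trans (ler_norm _))//; exact: le_lq_normy iI.
rewrite ler_wpM2r ?lq_norm_ge0// -lee_fin fineK ?mean_residual_norm_fin_num//.
rewrite -sumEFin; under eq_bigr do rewrite EFinM -mu_pi.
apply: sum_set1_le_integral => // [|i]; first exact: fset_uniq.
by rewrite lee_fin residual_norm_ge0.
Qed.

Lemma expected_sqr_schwarz_step_error_le m w (s : R := m.+2%:R^-1) :
  (\int[mu]_i (`|u - schwarz_step a Ri Ti u m i w|_a ^+ 2)%:E <=
   ((1 - s) ^+ 2 * `|u - w|_a ^+ 2 + s ^+ 2 * C)%:E)%E.
Proof.
set E := fun i => `|u - schwarz_step a Ri Ti u m i w|_a ^+ 2.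
set e := u - w; set K := (1 - s) ^+ 2 * _ + _.
have cross_ge0 : 0 <= 2 * (1 - s) * s.
  by rewrite !mulr_ge0 ?invr_ge0 ?subr_ge0 ?invf_le1 ?ler1n.
pose D := 2 * (1 - s) * s * A_space_norm x.
have D_ge0 : 0 <= D by rewrite mulr_ge0// A_space_norm_ge0 ?leey.
have E_ge0 i : (0 <= (E i)%:E)%E by rewrite lee_fin sqr_ge0.
have Drho_ge0 i : (0 <= D%:E * (residual_norm e i)%:E)%E.
  by rewrite -EFinM lee_fin mulr_ge0// residual_norm_ge0.
have : (\int[mu]_i ((E i)%:E + D%:E * (residual_norm e i)%:E) <=
        (K + 2 * (1 - s) * s * re_form a e u)%:E)%E.
  apply: integral_probability_le => // i.
  rewrite adde_ge0//= -EFinM -EFinD lee_fin.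
  have := sqr_schwarz_step_error_le m w i (A_space_norm x).
  rewrite -/s -/e -/(E i) /K /D; lra.
rewrite ge0_integralD// ge0_integralZl//; last first.
  by move=> i _; rewrite lee_fin residual_norm_ge0.
rewrite -/(mean_residual_norm e) -(fineK (mean_residual_norm_fin_num e)).
rewrite -leeBrDr// => /le_trans; apply.
rewrite -EFinM -EFinB lee_fin.
have := ler_wpM2l cross_ge0 (re_form_le_mean_residual_norm e).
rewrite /D; lra.
Qed.

End random_step.

Variables (d : measure_display) (Omega : measurableType d).
Variables (P : probability Omega R) (idx : nat -> {RV P >-> nat}).
Hypothesis idx_pi : forall m i : nat,
  distribution P (idx m) [set i] = (pi i)%:E.
Hypothesis idx_indep : mutually_independent idx.

Definition mean_next_sqr_error m (t : m.-tuple nat) : \bar R :=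
  (\int[distribution P (idx m)]_i (form_norm a
     (u - schwarz_step a Ri Ti u m i (iterate (nth 0%N t) m)) ^+ 2)%:E)%E.

Definition expected_sqr_error m : \bar R :=
  ('E_P[fun w => sqr_error (fun j => idx j w) m])%E.

Lemma schwarz_iter_history m w :
  iterate (fun j => idx j w) m = iterate (nth 0%N (history idx m w)) m.
Proof.
apply: eq_schwarz_iter => j jm.
by rewrite -[j in RHS]/(val (Ordinal jm)) nth_mktuple.
Qed.

Lemma measurable_fun_history (d' : measure_display) (T : measurableType d') m
    (f : m.-tuple nat -> T) :
  measurable_fun [set: Omega] (fun w => f (history idx m w)).
Proof.
apply: (measurableT_comp (f := f)); last exact: measurable_history.
apply: measurable_fun_countable => [|t]; first exact: countableP.
exact: measurable_set1_tuple.
Qed.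

Lemma expected_sqr_errorS m :
  expected_sqr_error m.+1 = (\int[P]_w mean_next_sqr_error (history idx m w))%E.
Proof.
pose next_error (z : m.-tuple nat * nat) : \bar R := (form_norm a
  (u - schwarz_step a Ri Ti u m z.2 (iterate (nth 0%N z.1) m)) ^+ 2)%:E.
rewrite /expected_sqr_error unlock.
rewrite -(ge0_integral_independent_rv (g := next_error)).
- by apply: eq_integral => w _; rewrite /sqr_error /= schwarz_iter_history.
- exact: history_independent.
- apply: measurable_fun_countable => [|[t i]]; first exact: countableP.
  rewrite (_ : [set (t, i)] = [set t] `*` [set i]).
    by apply: measurableX => //; exact: measurable_set1_tuple.
  by apply/seteqP; split=> -[s j] /= [-> ->].
- by move=> z; rewrite lee_fin sqr_ge0.
Qed.

Lemma expected_sqr_errorS_le m (s : R := m.+2%:R^-1) :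
  (expected_sqr_error m.+1 <=
   ((1 - s) ^+ 2)%:E * expected_sqr_error m + (s ^+ 2 * C)%:E)%E.
Proof.
pose error (t : m.-tuple nat) := (sqr_error (nth 0%N t) m)%:E.
have -> : expected_sqr_error m = (\int[P]_w error (history idx m w))%E.
  rewrite /expected_sqr_error unlock; apply: eq_integral => w _.
  by rewrite /error /sqr_error schwarz_iter_history.
pose bound t := (((1 - s) ^+ 2)%:E * error t + (s ^+ 2 * C)%:E)%E.
rewrite expected_sqr_errorS.
apply: (@le_trans _ _ (\int[P]_w bound (history idx m w))%E).
  apply: ge0_le_integral => //.
  - by move=> w _; apply: integral_ge0 => i _; rewrite lee_fin sqr_ge0.
  - exact: measurable_fun_history.
  - exact: measurable_fun_history.
  - move=> w _; rewrite /bound -EFinM -EFinD.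
    exact: (expected_sqr_schwarz_step_error_le (idx_pi m)).
rewrite integral_probability_affine ?sqr_ge0//.
- exact: measurable_fun_history.
- by move=> w; rewrite lee_fin sqr_ge0.
- by rewrite mulr_ge0 ?sqr_ge0 ?schwarz_constant_ge0.
Qed.

Lemma expected_sqr_error_le m : (expected_sqr_error m <= (C / m.+1%:R)%:E)%E.
Proof.
apply: harmonic_decay => [|n]; last exact: expected_sqr_errorS_le.
rewrite /expected_sqr_error /sqr_error /= subr0 expectation_cst lee_fin.
exact: sqr_solution_le_schwarz_constant.
Qed.

End random_ordering.

End schwarz_iteration.

Theorem theorem1 (R : realType) (k : scalar_kind)
  (V : hilbert R k)
  (V_separable : exists2 D : set V, countable D & dense D)
  (a : {hermitian_sym V for @scalar_conj R k})
  (a_continuous :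
     continuous (fun p : V * V => a p.1 p.2 : (scalar R k)^o))
  (a_coercive : exists2 c : scalar R k, 0 < c &
     forall v : V, c * `|v| ^+ 2 <= a v v)
  (F : {linear V -> scalar R k | @scalar_conj R k \; *%R})
  (F_bounded : exists M : scalar R k, forall v : V, `|F v| <= M * `|v|)
  (Vi : nat -> hilbert R k)
  (Ri : forall i, {linear Vi i -> V})
  (span_dense : forall (v : V) (e : R), 0 < e ->
     exists2 x : V, splitting_span Ri [set: nat] x & form_norm a (v - x) < e)
  (Lambda : R)
  (Ri_bounded : forall (i : nat) (w : Vi i),
     form_norm a (Ri i w) <= Lambda * form_norm (hdot (Vi i)) w)
  (Ti : forall i, V -> Vi i)
  (Ti_def : forall (i : nat) (v : V) (w : Vi i),
     hdot (Vi i) (Ti i v) w = a v (Ri i w))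
  (u : V)
  (u_solution : forall v : V, a u v = F v) :
  (* a) greedy ordering *)
  (forall (beta : R) (idx : nat -> nat),
     0 < beta <= 1 ->
     (forall m : nat,
        let r := residual Ti u (schwarz_iter a Ri Ti u idx m) in
        ((beta ^+ 2)%:E *
           ereal_sup (range (fun i : nat =>
             (scalar_re (hdot (Vi i) (r i) (r i)))%:E))
         <= (scalar_re (hdot (Vi (idx m)) (r (idx m)) (r (idx m))))%:E)%E) ->
     forall x : A_space Ri (fun=> 1) 1%:E, A_space_image a x u ->
     forall m : nat,
       form_norm a (u - schwarz_iter a Ri Ti u idx m) ^+ 2 <=
       2 * (form_norm a u ^+ 2 + (Lambda / beta) ^+ 2 * A_space_norm x ^+ 2)
         / (m.+1)%:R)
  /\
  (* b) random ordering *)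
  (forall (d : measure_display) (Omega : measurableType d)
     (P : probability Omega R) (pi : nat -> R) (idx : nat -> {RV P >-> nat}),
     prob_distribution pi ->
     (forall m i : nat, distribution P (idx m) [set i] = (pi i)%:E) ->
     mutually_independent idx ->
     forall x : A_space Ri pi +oo%E, A_space_image a x u ->
     forall m : nat,
       ('E_P[fun w => (form_norm a
               (u - schwarz_iter a Ri Ti u (fun j => idx j w) m) ^+ 2)%R]
        <= (2 * (form_norm a u ^+ 2 + Lambda ^+ 2 * A_space_norm x ^+ 2)
              / (m.+1)%:R)%:E)%E).
Proof.
have a_ge0 v : 0 <= a v v.
  have [c c_gt0 /(_ v)] := a_coercive.
  by apply: le_trans; rewrite mulr_ge0 ?exprn_ge0// ltW.
split=> [beta idx /andP[beta_gt0 _] greedy x xu m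
        |d Omega P pi idx _ idx_pi idx_indep x xu m].
- have -> : (Lambda / beta) ^+ 2 * A_space_norm x ^+ 2 =
      Lambda ^+ 2 * (A_space_norm x / beta) ^+ 2.
    by field; rewrite gt_eqF.
  exact: (greedy_sqr_error_le a_ge0 Ri_bounded Ti_def xu beta_gt0 greedy).
- exact: (expected_sqr_error_le a_ge0 Ri_bounded Ti_def xu idx_pi idx_indep).
Qed.
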